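(* Let $d$ be a positive integer and let $\{X_{\mathbf n},\mathbf n\in\mathbb{Z}_+^d\}$ be a $d$-dimensional array of real-valued random variables. Consider the following statement (A): there exists a measurable function $\phi$ defined on $[0,\infty)$ with $\phi(0)=0$ such that $\dfrac{\phi(t)}{t}\to\infty$ as $t\to\infty$ and $$\sup_{\mathbf n\succ\mathbf 1}\frac{1}{|\mathbf n|}\sum_{\mathbf i\prec\mathbf n}\mathbb{E}\big(\phi(|X_{\mathbf i}|)\big)<\infty .$$ (i) If (A) holds, then $\{X_{\mathbf n},\mathbf n\in\mathbb{Z}_+^d\}$ is uniformly integrable in the Cesàro sense. (ii) If $\{X_{\mathbf n},\mathbf n\in\mathbb{Z}_+^d\}$ is uniformly integrable in the Cesàro sense, then (A) holds. Moreover, $\phi$ can be chosen so that $\dfrac{\phi(t)}{t}$ is increasing.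
   Context: All random variables are defined on a common probability space $(\Omega,\mathcal{F},\mathbb{P})$, and $\mathbb{E}$ denotes expectation. $\mathbb{Z}_+^d$ is the set of $d$-tuples of positive integers. For $\mathbf m=(m_1,\dots,m_d)$ and $\mathbf n=(n_1,\dots,n_d)$ in $\mathbb{Z}_+^d$, $\mathbf m\prec\mathbf n$ (equivalently $\mathbf n\succ\mathbf m$) means $m_i\le n_i$ for all $1\le i\le d$; $|\mathbf n|=\prod_{i=1}^d n_i$; $\mathbf 1=(1,\dots,1)$. Sums over $\mathbf i\prec\mathbf n$ run over $\mathbf i\in\mathbb{Z}_+^d$. A $d$-dimensional array of real-valued random variables $\{X_{\mathbf n},\mathbf n\in\mathbb{Z}_+^d\}$ is said to be uniformly integrable in the Cesàro sense if $$\lim_{a\to\infty}\ \sup_{\mathbf n\succ\mathbf 1}\frac{1}{|\mathbf n|}\sum_{\mathbf i\prec\mathbf n}\mathbb{E}\big(|X_{\mathbf i}|\,\mathbf 1(|X_{\mathbf i}|>a)\big)=0,$$ where $\mathbf 1(\cdot)$ denotes the indicator function of an event.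
   Formalization: The function φ in (A) is required to be nonnegative on [0,∞): for signed φ the expectations may be undefined and (i) fails, since large negative values of φ at small arguments can cancel the large positive ones. *)

(* Defs.v *)
From HB Require Import structures.
From mathcomp Require Import all_boot all_order all_algebra.
From mathcomp Require Import all_classical all_reals all_analysis.

Set Implicit Arguments.
Unset Strict Implicit.
Unset Printing Implicit Defensive.

Import Order.TTheory GRing.Theory Num.Theory.
Import numFieldNormedType.Exports.

Local Open Scope classical_set_scope.
Local Open Scope ring_scope.

Definition posint := {n : nat | (0 < n)%N}.

Definition multiindex (d : nat) := {ffun 'I_d -> posint}.

Definition idx_one (d : nat) : multiindex d :=
  [ffun=> exist (fun n : nat => (0 < n)%N) 1%N isT].

Definition idx_le (d : nat) (m n : multiindex d) : Prop :=
  forall k : 'I_d, (val (m k) <= val (n k))%N.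

Definition idx_vol (d : nat) (n : multiindex d) : nat :=
  (\prod_(k < d) val (n k))%N.

(* By this lemma the sum over [i \in [set i | idx_le i n]] below is a genuine
   finite sum: [\sum_(i \in A)] would be 0 on an infinite support. *)
Lemma finite_idx_box (d : nat) (n : multiindex d) :
  finite_set [set i : multiindex d | idx_le i n].
Proof.
pose N := (\max_(k < d) val (n k))%N.
pose f (i : {ffun 'I_d -> 'I_N}) : multiindex d :=
  [ffun k => exist (fun m : nat => (0 < m)%N) (i k).+1 isT].
apply: (@sub_finite_set _ _ (f @` setT)); last first.
  by apply: finite_image; exact: finite_finset.
move=> i /= le_in.
have lt_iN k : ((val (i k)).-1 < N)%N.
  rewrite prednK ?(valP (i k)) //; apply: leq_trans (le_in k) _.
  exact: (@leq_bigmax _ (fun k => val (n k))).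
exists [ffun k => Ordinal (lt_iN k)] => //.
apply/ffunP => k; apply: val_inj.
by rewrite !ffunE /= prednK ?(valP (i k)).
Qed.

(* sup over n of |n|^-1 * sum_(i <= n) F i, in the extended reals *)
Definition cesaro_sup (R : realType) (d : nat) (F : multiindex d -> \bar R) :
    \bar R :=
  ereal_sup
    [set ((idx_vol n)%:R^-1)%:E * \sum_(i \in [set i | idx_le i n]) F i
      | n in [set n | idx_le (idx_one d) n]]%E.

Definition cesaro_uniformly_integrable (disp : measure_display)
    (T : measurableType disp) (R : realType) (P : probability T R) (d : nat)
    (X : multiindex d -> {RV P >-> R}) : Prop :=
  cesaro_sup (fun i =>
    'E_P[fun w => (`|X i w| * \1_[set w' | a < `|X i w'|] w)%R])%E
  @[a --> +oo%R] --> 0%E.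

(* [phi] is only relevant on [0, +oo[, where it is real-valued and nonnegative
   so that the expectations of phi(|X_i|) always make sense in [0, +oo]. *)
Definition cesaro_test_function (disp : measure_display)
    (T : measurableType disp) (R : realType) (P : probability T R) (d : nat)
    (X : multiindex d -> {RV P >-> R}) (phi : R -> R) : Prop :=
  [/\ measurable_fun (`[0, +oo[ : set R) phi,
      forall t, 0 <= t -> 0 <= phi t,
      phi 0 = 0,
      phi t / t @[t --> +oo] --> +oo
    & (cesaro_sup (fun i => 'E_P[fun w => phi `|X i w|%R]) < +oo)%E].

(* Main.v *)
(* For the converse, let H(a) be the Cesàro supremum of the tail expectations
   E(|X_i| 1(|X_i| > a)), and pick thresholds a_k >= k with H(a_k) <= 2^-(k+1).
   The expectation of |X_i| * #{k | a_k < |X_i|} is the sum over k of the tail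
   expectations at a_k, so its Cesàro supremum is at most 1, while
   t |-> #{k | a_k < t} is nondecreasing and unbounded. Adding 1 - exp (- t) to
   this count makes phi(t) / t strictly increasing and costs at most E |X_i|,
   whose Cesàro supremum is bounded by a_0 + H(a_0). *)
Require Import Defs.
From HB Require Import structures.
From mathcomp Require Import all_boot all_order all_algebra.
From mathcomp Require Import all_classical all_reals all_analysis.
From mathcomp Require Import measurable_realfun.

Import Order.TTheory GRing.Theory Num.Theory.
Import numFieldNormedType.Exports.

Local Open Scope classical_set_scope.
Local Open Scope ring_scope.

(** * Algebra and order properties of Cesàro means over boxes *)

Section CesaroMean.
Context {R : realType} {d : nat}.
Implicit Types (F G : multiindex d -> \bar R) (n : multiindex d).
Local Open Scope ereal_scope.

(** Has literally the form of the members of the set inside [cesaro_sup], so the two match by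
    conversion. *)
Definition cesaro_mean F n : \bar R :=
  ((idx_vol n)%:R^-1)%:E * \sum_(i \in [set i | idx_le i n]) F i.

Lemma cesaro_meanE F n : cesaro_mean F n =
  ((idx_vol n)%:R^-1)%:E *
  \sum_(i <- finmap.enum_fset (fset_set [set i | idx_le i n])) F i.
Proof. by rewrite /cesaro_mean fsbig_finite//; exact: finite_idx_box. Qed.

Lemma idx_vol_gt0 n : (0 < idx_vol n)%N.
Proof. by rewrite prodn_cond_gt0// => k _; exact: (valP (n k)). Qed.

Lemma inv_idx_vol_ge0 n : 0 <= ((idx_vol n)%:R^-1 : R)%:E.
Proof. by rewrite lee_fin invr_ge0. Qed.

Lemma cesaro_mean_le_sup F n : cesaro_mean F n <= cesaro_sup F.
Proof.
apply: ereal_sup_ubound; exists n => //= k.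
by rewrite ffunE /=; exact: (valP (n k)).
Qed.

Lemma cesaro_sup_le F M : (forall n, cesaro_mean F n <= M) -> cesaro_sup F <= M.
Proof. by move=> FM; apply: ge_ereal_sup => _ [n _ <-]; exact: FM. Qed.

Lemma cesaro_mean_ge0 F n : (forall i, 0 <= F i) -> 0 <= cesaro_mean F n.
Proof.
move=> F0; rewrite cesaro_meanE.
by apply: mule_ge0; [exact: inv_idx_vol_ge0 | exact: sume_ge0].
Qed.

Lemma cesaro_sup_ge0 F : (forall i, 0 <= F i) -> 0 <= cesaro_sup F.
Proof.
move=> F0; apply: le_trans (cesaro_mean_le_sup F (idx_one d)).
exact: cesaro_mean_ge0.
Qed.

Lemma le_cesaro_mean F G n :
  (forall i, F i <= G i) -> cesaro_mean F n <= cesaro_mean G n.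
Proof.
move=> FG; rewrite !cesaro_meanE; apply: lee_wpmul2l.
  exact: inv_idx_vol_ge0.
exact: lee_sum.
Qed.

Lemma cesaro_meanD F G n : (forall i, 0 <= F i) -> (forall i, 0 <= G i) ->
  cesaro_mean (fun i => F i + G i) n = cesaro_mean F n + cesaro_mean G n.
Proof.
move=> F0 G0; rewrite !cesaro_meanE big_split/= ge0_muleDr//; exact: sume_ge0.
Qed.

Lemma cesaro_meanZ (c : \bar R) F n : (forall i, 0 <= F i) ->
  cesaro_mean (fun i => c * F i) n = c * cesaro_mean F n.
Proof. by move=> F0; rewrite !cesaro_meanE -ge0_sume_distrr// muleCA. Qed.

(** Nonnegativity lets the finite box sum pass through the series; this is how the tail means at all
    thresholds get summed. *)
Lemma cesaro_mean_nneseries (F : nat -> multiindex d -> \bar R) n :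
  (forall k i, 0 <= F k i) ->
  cesaro_mean (fun i => \sum_(0 <= k <oo) F k i) n =
  \sum_(0 <= k <oo) cesaro_mean (F k) n.
Proof.
move=> F0; rewrite !cesaro_meanE -nneseries_sum// -nneseriesZl; last first.
  by move=> k _; exact: sume_ge0.
by apply: eq_eseriesr => k _; rewrite cesaro_meanE.
Qed.

(** Lowering every coordinate by one embeds the box into a product of initial segments of lengths
    [n k], whose cardinality is the volume. *)
Lemma card_idx_box n :
  (size (finmap.enum_fset (fset_set [set i : multiindex d | idx_le i n])) <=
    idx_vol n)%N.
Proof.
(* A finite function type has a single codomain: [N] bounds all coordinates at once, and [family]
   restores the individual bounds. *)
pose N := (\max_(k < d) val (n k))%N.
have leN k : (val (n k) <= N)%N := @leq_bigmax _ (fun k => val (n k)) k.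
pose f (g : {ffun 'I_d -> 'I_N}) : multiindex d :=
  [ffun k => exist (fun m : nat => (0 < m)%N) (g k).+1 isT].
pose A := family (fun k : 'I_d => [pred j : 'I_N | (j < val (n k))%N]).
have cardA : #|A| = idx_vol n.
  rewrite card_family foldrE big_map big_enum/= /idx_vol.
  apply: eq_big => // k _.
  rewrite -sum1_card -(big_ord_widen _ (fun=> 1%N) (leN k)).
  by rewrite sum_nat_const card_ord muln1.
rewrite -cardA cardE -(size_map f); apply: uniq_leq_size.
  exact: finmap.fset_uniq.
move=> i; rewrite in_fset_set; last exact: finite_idx_box.
rewrite inE/= => le_in.
have i_lt k : ((val (i k)).-1 < val (n k))%N.
  by rewrite prednK ?le_in//; exact: (valP (i k)).
apply/mapP; exists [ffun k => Ordinal (leq_trans (i_lt k) (leN k))].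
  by rewrite mem_enum; apply/familyP => k; rewrite ffunE; exact: i_lt.
apply/ffunP => k; apply: val_inj.
by rewrite !ffunE/= prednK//; exact: (valP (i k)).
Qed.

Lemma cesaro_mean_cst_le (c : R) n : (0 <= c)%R ->
  cesaro_mean (fun=> c%:E) n <= c%:E.
Proof.
move=> c0; rewrite cesaro_meanE sumEFin -EFinM lee_fin.
rewrite big_const_seq iter_addr_0 count_predT.
rewrite ler_pdivrMl ?ltr0n ?idx_vol_gt0// mulr_natl.
by rewrite ler_wpMn2l// card_idx_box.
Qed.

End CesaroMean.

(** For a nonnegative function, convergence to 0 is an eventual upper bound by each positive real;
    such a bound also forces eventual finiteness. *)
Lemma nneg_cvge0P {R : realType} (f : R -> \bar R) :
  (forall a, 0 <= f a)%E ->
  (f a @[a --> +oo%R] --> 0%E) <->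
  (forall e : R, 0 < e -> \forall a \near +oo%R, (f a <= e%:E)%E).
Proof.
move=> f0; split.
  move=> /fine_cvgP[ffin /cvgr0Pnorm_le fcvg] e e0.
  near=> a; rewrite -[f a]fineK; last by near: a.
  rewrite lee_fin (le_trans (ler_norm _))//.
  by near: a; exact: fcvg.
move=> fle; apply/fine_cvgP; split.
  near=> a; rewrite ge0_fin_numE// (@le_lt_trans _ _ 1%:E)//?ltry//.
  by near: a; exact: fle.
apply/cvgr0Pnorm_le => e e0; near=> a.
rewrite /= ger0_norm ?fine_ge0// -lee_fin fineK; first by near: a; exact: fle.
rewrite ge0_fin_numE// (@le_lt_trans _ _ e%:E)//?ltry//.
by near: a; exact: fle.
Unshelve. all: by end_near. Qed.

(** * Tail expectations of a single random variable *)

Section TailExpectation.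
Context {disp : measure_display} {T : measurableType disp} {R : realType}
  {P : probability T R}.
Implicit Types (Y : {RV P >-> R}) (phi : R -> R) (a : R).

Definition tail_expectation a Y : \bar R :=
  'E_P[fun w => `|Y w| * \1_[set w' | a < `|Y w'|] w].

(** Exhibits the integrand as a function of [|Y w|] alone, which gives measurability by composition
    and matches the terms of [jump_series]. *)
Lemma tail_indicE a Y w :
  `|Y w| * \1_[set w' | a < `|Y w'|] w =
  `|Y w| * \1_(`]a, +oo[ : set R) `|Y w|.
Proof.
congr (_ * (nat_of_bool _)%:R); apply/idP/idP; rewrite !inE/= in_itv/= andbT//.
Qed.

Lemma measurable_normRV Y : measurable_fun setT (fun w => `|Y w|).
Proof. by apply: measurableT_comp. Qed.

Lemma measurable_tail a Y :
  measurable_fun setT (fun w => `|Y w| * \1_[set w' | a < `|Y w'|] w).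
Proof.
under eq_fun do rewrite tail_indicE.
apply: measurable_funM; first exact: measurable_normRV.
apply: measurableT_comp (measurable_normRV Y).
exact: measurable_indic.
Qed.

Lemma tail_expectation_ge0 a Y : (0 <= tail_expectation a Y)%E.
Proof. exact: expectation_ge0. Qed.

(** A Markov-type bound: where [|Y| > a], one has [|Y| <= phi |Y| / M]; elsewhere the tail integrand
    is 0 and the right side is nonnegative. *)
Lemma tail_expectation_le phi Y (M a : R) :
  measurable_fun (`[0, +oo[ : set R) phi ->
  (forall t, 0 <= t -> 0 <= phi t) -> 0 < M ->
  (forall t, a < t -> M * t <= phi t) ->
  (tail_expectation a Y <= M^-1%:E * 'E_P[fun w => phi `|Y w|%R])%E.
Proof.
move=> mphi phi0 M0 Mphi; rewrite /tail_expectation unlock.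
have mphiY : measurable_fun setT (fun w => phi `|Y w|).
  apply: (measurable_comp _ _ mphi (measurable_normRV Y)) => //.
  by move=> _ [w _ <-]; rewrite /= in_itv/= andbT.
rewrite -ge0_integralZl_EFin//; last 3 first.
- by move=> w _; rewrite lee_fin phi0.
- exact/measurable_EFinP.
- by rewrite invr_ge0 ltW.
apply: ge0_le_integral => //.
- exact/measurable_EFinP/measurable_tail.
- by apply/measurable_EFinP; exact: measurable_funM.
move=> w _; rewrite -EFinM lee_fin indicE.
have [|_] := boolP (w \in _); last first.
  by rewrite mulr0 mulr_ge0 ?phi0// invr_ge0 ltW.
by rewrite inE/= mulr1 => aY; rewrite ler_pdivlMl// Mphi.
Qed.

(** Split at level [a]: below it [|Y|] is at most the constant, above it [|Y|] is the tail
    integrand. *)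
Lemma expectation_norm_le_tail a Y : 0 <= a ->
  ('E_P[fun w => `|Y w|%R] <= a%:E + tail_expectation a Y)%E.
Proof.
move=> a0; rewrite -(expectation_cst P a) /tail_expectation unlock.
rewrite -ge0_integralD//; last 2 first.
- exact/measurable_EFinP.
- exact/measurable_EFinP/measurable_tail.
apply: ge0_le_integral => //.
- exact/measurable_EFinP/measurable_normRV.
- apply/measurable_EFinP; apply: measurable_funD => //; exact: measurable_tail.
move=> w _; rewrite lee_fin indicE /cst/=.
have [_|] := boolP (w \in _); first by rewrite mulr1 lerDr.
by rewrite notin_setE/= mulr0 addr0 => /negP; rewrite -leNgt.
Qed.

End TailExpectation.

(** * Construction of the test function from a sequence of thresholds *)

Section TestFunction.
Context {R : realType} (a : nat -> R) (a_ge : forall k, k%:R <= a k).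

(** The counting function of the thresholds below [t], kept as a series so that it can be integrated
    termwise. *)
Definition jump_series (t : R) : \bar R :=
  (\sum_(0 <= k <oo) (\1_(`]a k, +oo[ : set R) t)%:E)%E.

(** This is the ratio [phi t / t] for the test function to come. *)
Definition slope (t : R) : R := fine (jump_series t) + (1 - expR (- t)).

Lemma jump_series_ge0 t : (0 <= jump_series t)%E.
Proof. by apply: nneseries_ge0 => k _ _; rewrite lee_fin. Qed.

(** If [t <= N <= k] then [t <= a k], so every term from index [N] on vanishes. *)
Lemma jump_series_fin_num t : jump_series t \is a fin_num.
Proof.
pose N := Num.bound `|t|.
have tN : t <= N%:R.
  by rewrite (le_trans (ler_norm t))// ltW// archi_boundP.
rewrite ge0_fin_numE ?jump_series_ge0// /jump_series.
rewrite (nneseries_split 0 N); last first.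
  by move=> k _; rewrite lee_fin.
rewrite add0n eseries0 ?adde0 ?sumEFin ?ltry// => k Nk _.
rewrite indicE memNset//= in_itv/= andbT; apply/negP; rewrite -leNgt.
by rewrite (le_trans tN)// (le_trans _ (a_ge k))// ler_nat.
Qed.

Lemma le_jump_series : {homo jump_series : s t / s <= t >-> (s <= t)%E}.
Proof.
move=> s t st; apply: lee_nneseries => [k _ _|k _]; rewrite lee_fin// !indicE.
have [|//] := boolP (s \in _); rewrite inE/= in_itv/= andbT => aks.
by rewrite mem_set//= in_itv/= andbT (lt_le_trans aks).
Qed.

Lemma slope_lt : {homo slope : s t / s < t}.
Proof.
move=> s t st; rewrite /slope ler_ltD//.
  by rewrite fine_le ?jump_series_fin_num// le_jump_series// ltW.
by rewrite ltrD2l ltrN2 ltr_expR ltrN2.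
Qed.

Lemma slope_ge0 t : 0 <= t -> 0 <= slope t.
Proof.
move=> t0; rewrite addr_ge0 ?fine_ge0 ?jump_series_ge0// subr_ge0.
by rewrite -expR0 ler_expR oppr_le0.
Qed.

Lemma jump_series_cvgy (N : nat) :
  \forall t \near +oo, (N%:R%:E <= jump_series t)%E.
Proof.
(* Once [t] exceeds the first [N] thresholds, the first [N] indicators all equal 1. *)
suff : \forall t \near +oo%R,
    \sum_(0 <= k < N) \1_(`]a k, +oo[ : set R) t = N%:R :> R.
  apply: filterS => t <-; rewrite -sumEFin.
  by apply: nneseries_lim_ge => k _ _; rewrite lee_fin.
elim: N => [|N IHN]; first by apply: nearW => t; rewrite big_geq.
near=> t; rewrite big_nat_recr//= (near IHN t)// indicE mem_set/= ?natr1//.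
by rewrite in_itv/= andbT; near: t; exact: nbhs_pinfty_gt (num_real _).
Unshelve. all: by end_near. Qed.

Lemma slope_cvgy : slope t @[t --> +oo] --> +oo.
Proof.
apply/cvgryPge => A.
pose N := Num.bound `|A|.
near=> t.
have t0 : 0 <= t by near: t; exact: nbhs_pinfty_ge (num_real _).
apply: (@le_trans _ _ N%:R).
  by rewrite (le_trans (ler_norm A))// ltW// archi_boundP.
rewrite -[N%:R]addr0; apply: lerD; last first.
  by rewrite subr_ge0 -expR0 ler_expR oppr_le0.
rewrite -lee_fin fineK ?jump_series_fin_num//.
by near: t; exact: jump_series_cvgy.
Unshelve. all: by end_near. Qed.

Lemma measurable_slope : measurable_fun setT slope.
Proof.
apply: nondecreasing_measurable => // s t.
by rewrite le_eqVlt => /predU1P[->//|/slope_lt/ltW].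
Qed.

(** The counting part is integrated termwise, by nonnegativity; the remaining part contributes at
    most [|Y|] because [1 - expR (- t) <= 1]. *)
Lemma expectation_slope_le {disp : measure_display} {T : measurableType disp}
    {P : probability T R} (Y : {RV P >-> R}) :
  ('E_P[fun w => (`|Y w| * slope `|Y w|)%R] <=
   \sum_(0 <= k <oo) tail_expectation (a k) Y + 'E_P[fun w => `|Y w|%R])%E.
Proof.
pose f k w := (`|Y w| * \1_[set w' | a k < `|Y w'|] w)%:E.
have f0 k w : (0 <= f k w)%E by rewrite lee_fin mulr_ge0.
have mf k : measurable_fun setT (f k) by exact/measurable_EFinP/measurable_tail.
have tailE k : tail_expectation (a k) Y = (\int[P]_w f k w)%E.
  by rewrite /tail_expectation unlock.
rewrite (eq_eseriesr (fun k _ => tailE k)) -integral_nneseries// unlock.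
have mY := measurable_normRV Y.
rewrite -ge0_integralD//; last 3 first.
- by move=> w _; exact: nneseries_ge0.
- exact: ge0_emeasurable_sum.
- exact/measurable_EFinP.
apply: ge0_le_integral => //.
- by move=> w _; rewrite lee_fin mulr_ge0 ?slope_ge0.
- apply/measurable_EFinP/measurable_funM => //.
  exact: measurableT_comp measurable_slope mY.
- apply: emeasurable_funD; first exact: ge0_emeasurable_sum.
  exact/measurable_EFinP.
move=> w _; rewrite mulrDr EFinD; apply: leeD.
  rewrite EFinM fineK ?jump_series_fin_num// -nneseriesZl//.
  by apply: lee_nneseries => [k _ _|k _]; rewrite ?mule_ge0// /f tail_indicE.
by rewrite lee_fin ler_piMr// gerBl expR_ge0.
Qed.

End TestFunction.

(** * The two implications *)

Lemma test_function_cesaro_uniformly_integrable (disp : measure_display)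
    (T : measurableType disp) (R : realType) (P : probability T R) (d : nat)
    (X : multiindex d -> {RV P >-> R}) (phi : R -> R) :
  cesaro_test_function X phi -> cesaro_uniformly_integrable X.
Proof.
move=> [mphi phi0 _ phicvg].
set S := cesaro_sup _ => Sfin.
have Ephi0 i : (0 <= 'E_P[fun w => phi `|X i w|%R])%E.
  by apply: expectation_ge0 => w; exact: phi0.
have S0 : (0 <= S)%E by exact: cesaro_sup_ge0.
apply/nneg_cvge0P.
  by move=> a; apply: cesaro_sup_ge0 => i; exact: tail_expectation_ge0.
(* With this [M], [S / M = e * S / (S + 1) <= e]; the added 1 keeps [M] positive when [S = 0]. *)
move=> e e0; pose M := (fine S + 1) / e.
have M0 : 0 < M by rewrite divr_gt0// ltr_wpDl ?fine_ge0.
have [A [_ Aphi]] := (cvgryPge _).1 phicvg M.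
near=> a.
have a0 : 0 < a by near: a; exact: nbhs_pinfty_gt (num_real _).
have Aa : A < a by near: a; exact: nbhs_pinfty_gt (num_real _).
apply: (@le_trans _ _ (M^-1%:E * S)%E); last first.
  rewrite -(@fineK _ S) ?ge0_fin_numE// -EFinM lee_fin invf_div.
  by rewrite mulrAC ler_pdivrMr ?ltr_wpDl ?fine_ge0// ler_wpM2l ?lerDl// ltW.
apply: cesaro_sup_le => n.
apply: (@le_trans _ _ (M^-1%:E *
    cesaro_mean (fun i => 'E_P[fun w => phi `|X i w|%R]) n)%E).
  rewrite -cesaro_meanZ//; apply: le_cesaro_mean => i.
  apply: tail_expectation_le => // t at_.
  rewrite -ler_pdivlMr ?(lt_trans a0)//; apply: Aphi.
  exact: lt_trans at_.
apply: lee_wpmul2l; first by rewrite lee_fin invr_ge0 ltW.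
exact: cesaro_mean_le_sup.
Unshelve. all: by end_near. Qed.

(** Returns the thresholds rather than just some test function, so that strict monotonicity of the
    ratio can be read off [slope_lt]. *)
Lemma cesaro_uniformly_integrable_slope (disp : measure_display)
    (T : measurableType disp) (R : realType) (P : probability T R) (d : nat)
    (X : multiindex d -> {RV P >-> R}) :
  cesaro_uniformly_integrable X -> exists2 a : nat -> R,
    forall k, k%:R <= a k & cesaro_test_function X (fun t => t * slope a t).
Proof.
pose H (t : R) := cesaro_sup (fun i => tail_expectation t (X i)).
have tail0 t i : (0 <= tail_expectation t (X i))%E.
  exact: tail_expectation_ge0.
move=> /(nneg_cvge0P H (fun t => cesaro_sup_ge0 _ (tail0 t))) Hle.
(* The bound is written in the form summed by [epsilon_trick0] with total 1. *)
have /choice[a aP] : forall k, exists t : R,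
    k%:R <= t /\ (H t <= (1 / (2 ^ k.+1)%:R)%:E)%E.
  move=> k; apply: (@filter_ex _ (pinfty_nbhs R)); near=> t; split.
    by near: t; exact: nbhs_pinfty_ge (num_real _).
  by near: t; apply: Hle; rewrite divr_gt0// ltr0n expn_gt0.
have a_ge k : k%:R <= a k by have [] := aP k.
exists a => //; split.
- by apply/measurable_funTS/measurable_funM => //; exact: measurable_slope.
- by move=> t t0; rewrite mulr_ge0 ?slope_ge0.
- by rewrite mul0r.
- apply: cvg_trans (slope_cvgy a a_ge); apply: near_eq_cvg.
  near=> t; rewrite mulrAC divff ?mul1r//.
  by rewrite gt_eqF//; near: t; exact: nbhs_pinfty_gt (num_real _).
(* The 1 bounds the summed tails; the rest bounds the mean of [|X i|] split at level [a 0]. *)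
apply: (@le_lt_trans _ _ (1%:E + ((a 0%N)%:E + H (a 0%N)))%E); last first.
  rewrite !lte_add_pinfty ?ltry//.
  by have [_ /le_lt_trans->//] := aP 0%N; rewrite ltry.
apply: cesaro_sup_le => n.
have sum0 i : (0 <= \sum_(0 <= k <oo) tail_expectation (a k) (X i))%E.
  by apply: nneseries_ge0 => k _ _.
have a00 : 0 <= a 0%N := a_ge 0%N.
apply: (@le_trans _ _ (cesaro_mean (fun i =>
    \sum_(0 <= k <oo) tail_expectation (a k) (X i) +
      ((a 0%N)%:E + tail_expectation (a 0%N) (X i)))%E n)).
  apply: le_cesaro_mean => i; apply: le_trans (expectation_slope_le a a_ge _) _.
  by apply: leeD => //; exact: expectation_norm_le_tail.
rewrite !cesaro_meanD//; last by move=> i; rewrite adde_ge0.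
apply: leeD; last first.
  by apply: leeD; [exact: cesaro_mean_cst_le | exact: cesaro_mean_le_sup].
rewrite cesaro_mean_nneseries//.
apply: le_trans (epsilon_trick0 xpredT (@ler01 R)).
apply: lee_nneseries => [k _ _|k _]; first exact: cesaro_mean_ge0.
by apply: le_trans (cesaro_mean_le_sup _ _) _; have [] := aP k.
Unshelve. all: by end_near. Qed.

Theorem theorem4 (disp : measure_display) (T : measurableType disp)
    (R : realType) (P : probability T R) (d : nat) (d_gt0 : (0 < d)%N)
    (X : multiindex d -> {RV P >-> R}) :
  ((exists phi : R -> R, cesaro_test_function X phi) ->
     cesaro_uniformly_integrable X)
  /\
  (cesaro_uniformly_integrable X ->
     exists phi : R -> R, cesaro_test_function X phi
       /\ (forall s t : R, 0 < s -> s < t -> phi s / s < phi t / t)).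
Proof.
split=> [[phi]|/cesaro_uniformly_integrable_slope[a a_ge phiP]].
  exact: test_function_cesaro_uniformly_integrable.
exists (fun t => t * slope a t); split=> // s t s0 st.
have slopeK u : 0 < u -> u * slope a u / u = slope a u.
  by move=> u0; rewrite mulrAC divff ?mul1r// gt_eqF.
rewrite !slopeK//; first exact: (slope_lt a a_ge).
exact: lt_trans st.
Qed.
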